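(* Let $n\ge 1$, let $I_1,I_2,\ldots,I_k$ be disjoint, nonempty subsets of $[n]$, and let $m_1,\ldots,m_k$ be non-negative integers. Then \[ \mathbb{E}\left[\binom{C_{I_1}(\sigma)}{m_1}\cdots\binom{C_{I_k}(\sigma)}{m_k}\right]\le \prod_{j=1}^k \frac{H(I_j)^{m_j}}{m_j!}, \] with equality if and only if $\sum_{j=1}^k m_j\max(I_j)\le n$.
   Context: $[n]=\{1,\ldots,n\}$. The expectation $\mathbb{E}$ is with respect to a uniformly random permutation $\sigma$ in the symmetric group $\mathcal{S}_n$ on $[n]$. For $I\subseteq[n]$, $C_I(\sigma)$ is the number of cycles of $\sigma$ whose lengths lie in $I$ (fixed points count as cycles of length 1), and $H(I)=\sum_{j\in I}1/j$. *)

(* Defs.v *)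
From mathcomp Require Import all_boot all_order all_algebra all_fingroup.

Set Implicit Arguments.
Unset Strict Implicit.
Unset Printing Implicit Defensive.

Import Order.TTheory GRing.Theory Num.Theory.
Local Open Scope ring_scope.

(* Cycle lengths are kept at their true value: a set of lengths is a subset   *)
(* of {0, ..., n} = 'I_n.+1, and [n] = {1, ..., n} leaves out 0. Permutations *)
(* act on 'I_n, a set with n elements.                                        *)
Definition bracket (n : nat) : {set 'I_n.+1} := [set i : 'I_n.+1 | (0 < i)%N].

Definition expectation (n : nat) (X : 'S_n -> rat) : rat :=
  (\sum_(s : 'S_n) X s) / #|{: 'S_n}|%:R.

(* [porbits s] contains the singleton orbits, so fixed points are counted.    *)
Definition cycle_count (n : nat) (I : {set 'I_n.+1}) (s : 'S_n) : nat :=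
  #|[set c in porbits s | [exists i in I, #|c| == i :> nat]]|.

Definition harmonic (n : nat) (I : {set 'I_n.+1}) : rat :=
  \sum_(i in I) (i%:R)^-1.

Definition max_length (n : nat) (I : {set 'I_n.+1}) : nat :=
  \max_(i in I) i.

(* Main.v *)
Require Import Defs.
From mathcomp Require Import all_boot all_order all_algebra all_fingroup.

Set Implicit Arguments.
Unset Strict Implicit.
Unset Printing Implicit Defensive.

Import Order.TTheory GRing.Theory Num.Theory.
Local Open Scope ring_scope.

(** Clearing the factorials turns each binomial coefficient into a falling
    factorial, so that the left-hand side counts tuples of distinct cycles, with
    [m j] of them having a length in [I j]; disjointness of the [I j] makes
    distinctness within each class the same as distinctness overall.

    A cycle can be peeled off a permutation: fixing a set [c] of size [l], the
    permutations of an [N]-set having [c] as a cycle correspond to pairs formed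
    by a cyclic permutation of [c], for which there are [(l-1)!] choices, and a
    permutation of the remaining [N - l] points ([sum_splice]).  Summed over the
    ['C(N, l)] possible [c] and divided by [N!], this has total weight [1/l] if
    [l <= N] and [0] otherwise.  Peeling off the chosen cycles one at a time
    ([momentE]), the expected number of tuples is
    [\sum 1 / (l_1 * ... * l_M)] over all length tuples with
    [l_1 + ... + l_M <= n], the [t]-th length being taken from its prescribed
    [I j].  Without the constraint on the total, this sum factors as the product
    of the harmonic sums.  All terms being positive, the inequality follows, and
    it is an equality exactly when every length tuple meets the constraint, which
    is to say when the tuple of maximal lengths does
    ([leif_truncated_product]).

    The number of cyclic permutations comes out of the same peeling
    ([card_cyclic_perms]), so the bijection is needed only once.  To make the
    induction possible, permutations of a subset [S] are represented as the
    permutations of the ambient type that satisfy [perm_on S]. *)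

(** * Peeling one cycle off a permutation *)

Section CyclesOn.

Variable T : finType.
Implicit Types (S c d : {set T}) (s t : {perm T}).
Local Open Scope nat_scope.

(** Restricting to orbits of points of [S] leaves out the spurious fixed points
    outside [S] of a permutation with support in [S]. *)
Definition cycles S s : {set {set T}} := [set porbit s x | x in S].

Definition cyclic_perms c : {set {perm T}} :=
  [set s | perm_on c s && (c \in cycles c s)].

Lemma eq_in_porbit S s t :
  perm_on S t -> {in S, s =1 t} -> {in S, porbit s =1 porbit t}.
Proof.
move=> St eq_st x Sx.
have powE i : (s ^+ i)%g x = (t ^+ i)%g x /\ (t ^+ i)%g x \in S.
  elim: i => [|i [IHe IHS]]; first by rewrite !expg0 !perm1.
  by rewrite !expgSr !permM IHe eq_st // perm_closed.
by apply/setP=> y; apply/porbitP/porbitP=> -[i ->]; exists i;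
   case: (powE i).
Qed.

Lemma porbit_sub S s x : perm_on S s -> x \in S -> porbit s x \subset S.
Proof.
move=> Ss Sx; apply/subsetP=> _ /porbitP[i ->].
elim: i => [|i IH]; first by rewrite expg0 perm1.
by rewrite expgSr permM perm_closed.
Qed.

Lemma cycles_nonempty S s c : c \in cycles S s -> 0 < #|c|.
Proof. by case/imsetP=> x _ ->; rewrite lt0n card_porbit_neq0. Qed.

Lemma cycles_sub S s c : perm_on S s -> c \in cycles S s -> c \subset S.
Proof. by move=> Ss /imsetP[x Sx ->]; exact: porbit_sub. Qed.

Lemma cycles_stable S s c : c \in cycles S s -> s \in 'N(c | 'P)%g.
Proof.
case/imsetP=> x _ ->; apply/astabsP=> y; rewrite /= apermE.
by rewrite -!eq_porbit_mem -[s y]/((s ^+ 1)%g y) porbit_perm.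
Qed.

Lemma cyclic_perms_cycles c s :
  s \in cyclic_perms c -> cycles c s = [set c].
Proof.
rewrite inE => /andP[cs /[dup] /imsetP[x cx cE] c_cycle].
apply/eqP; rewrite eqEsubset sub1set c_cycle andbT.
apply/subsetP=> _ /imsetP[y cy ->]; rewrite inE.
by rewrite [X in _ == X]cE eq_porbit_mem -cE.
Qed.

(** The cycles of [s] partition [S]. *)
Lemma sum_card_cycles S s : perm_on S s -> \sum_(c in cycles S s) #|c| = #|S|.
Proof.
move=> Ss; rewrite -[RHS]sum1_card (partition_big_imset (porbit s)) /=.
apply: eq_bigr => c c_cycle; rewrite sum1_card; apply: eq_card => y.
have sub := subsetP (cycles_sub Ss c_cycle).
case/imsetP: c_cycle sub => x Sx -> sub.
rewrite [RHS]inE unfold_in /= eq_porbit_mem.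
rewrite -[LHS]/(y \in porbit s x) andbC.
by case: (boolP (y \in porbit s x)) => [/sub|].
Qed.

Lemma perm_on_widen S S' s : S \subset S' -> perm_on S s -> perm_on S' s.
Proof. by move=> SS' Ss; exact: subset_trans SS'. Qed.

Section Splice.

Variables (S c : {set T}).
Hypothesis cS : c \subset S.

Lemma splice_in t r :
  perm_on c t -> perm_on (S :\: c) r -> {in c, (t * r)%g =1 t}.
Proof.
move=> ct Scr x cx; rewrite permM (out_perm Scr) //.
by rewrite inE perm_closed // cx.
Qed.

Lemma splice_out t r :
  perm_on c t -> {in S :\: c, (t * r)%g =1 r}.
Proof. by move=> ct x /setDP[_ ncx]; rewrite permM (out_perm ct). Qed.

Lemma cycles_splice t r :
  t \in cyclic_perms c -> perm_on (S :\: c) r ->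
  cycles S (t * r)%g = c |: cycles (S :\: c) r.
Proof.
move=> tc Scr; rewrite -(cyclic_perms_cycles tc).
move: tc; rewrite inE => /andP[ct _]; rewrite /cycles.
rewrite -(eq_in_imset (eq_in_porbit ct (splice_in ct Scr))).
rewrite -(eq_in_imset (eq_in_porbit Scr (splice_out r ct))).
by rewrite -imsetU -[X in X :|: _](setIidPr cS) setID.
Qed.

(** The bijection [(t, r) |-> t * r] from cyclic permutations of [c] paired with
    permutations of [S :\: c], in the form of a change of summation variable: it
    is inverted by restricting to [c] and to its complement. *)
Lemma sum_splice (F : {set {set T}} -> nat) :
  \sum_(s | perm_on S s && (c \in cycles S s)) F (cycles S s :\ c) =
  #|cyclic_perms c| * \sum_(t | perm_on (S :\: c) t) F (cycles (S :\: c) t).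
Proof.
rewrite -sum_nat_const pair_big /=.
rewrite (reindex_onto (fun p : {perm T} * {perm T} => (p.1 * p.2)%g)
  (fun s => (restr_perm c s, restr_perm (~: c) s))) /=; last first.
  move=> s /andP[_ /cycles_stable sc]; apply/permP=> x; rewrite permM.
  have sc' : s \in 'N(~: c | 'P)%g by rewrite astabsC.
  have [cx|ncx] := boolP (x \in c).
    rewrite (restr_permE sc cx) (out_perm (restr_perm_on _ _)) //.
    by rewrite inE negbK (astabsP sc).
  rewrite (out_perm (restr_perm_on _ _) ncx) restr_permE //.
  by rewrite inE.
have splitP p : perm_on S (p.1 * p.2)%g && (c \in cycles S (p.1 * p.2)%g) &&
    ((restr_perm c (p.1 * p.2)%g, restr_perm (~: c) (p.1 * p.2)%g) == p) =
    (p.1 \in cyclic_perms c) && perm_on (S :\: c) p.2.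
  case: p => t r /=; apply/idP/idP.
    case/andP=> /andP[Sp c_cycle] /eqP[tE rE].
    have ct : perm_on c t by rewrite -tE restr_perm_on.
    have sc := cycles_stable c_cycle.
    have c'r : perm_on (~: c) r by rewrite -rE restr_perm_on.
    have Scr : perm_on (S :\: c) r.
      apply/subsetP=> x; rewrite !inE => rx.
      have := subsetP c'r x; rewrite !inE => /(_ rx) ncx; rewrite ncx /=.
      apply: contraNT rx => nSx.
      by have := out_perm Sp nSx; rewrite permM (out_perm ct ncx) => ->.
    rewrite Scr andbT inE ct /=.
    case/imsetP: c_cycle => x Sx cE.
    have cx : x \in c by rewrite cE porbit_id.
    apply/imsetP; exists x => //.
    by rewrite -(eq_in_porbit ct (splice_in ct Scr)).
  case/andP=> tc Scr; have ct : perm_on c t by move: tc; rewrite inE; case/andP.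
  have Sp : perm_on S (t * r)%g.
    by rewrite perm_onM ?(perm_on_widen cS ct) ?(perm_on_widen (subsetDl S c)).
  have c_cycle : c \in cycles S (t * r)%g.
    by rewrite cycles_splice // setU11.
  have sc := cycles_stable c_cycle.
  have sc' : (t * r)%g \in 'N(~: c | 'P)%g by rewrite astabsC.
  rewrite Sp c_cycle /=; apply/eqP; congr (_, _); apply/permP=> x.
    have [cx|ncx] := boolP (x \in c).
      by rewrite restr_permE // (splice_in ct Scr).
    by rewrite (out_perm (restr_perm_on _ _)) // (out_perm ct).
  have [cx|ncx] := boolP (x \in c).
    rewrite (out_perm (restr_perm_on _ _)) ?inE ?cx //.
    by rewrite (out_perm Scr) // inE cx.
  by rewrite (restr_permE sc') ?in_setC // permM (out_perm ct).
rewrite (eq_bigl _ _ splitP); apply: eq_bigr => -[t r] /= /andP[tc Scr].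
congr F; rewrite cycles_splice // setU1K //.
(* [c] is not a cycle on [S :\: c], because cycles are nonempty. *)
apply/negP=> /[dup] /cycles_nonempty + /(cycles_sub Scr).
by rewrite subsetD => /card_gt0P[x cx] /andP[_ /pred0P/(_ x)]; rewrite /= cx.
Qed.

End Splice.

(** * Counting cyclic permutations *)

Lemma sum_by_card S (f : nat -> nat) :
  \sum_(c : {set T} | c \subset S) f #|c| =
  \sum_(l < #|S|.+1) 'C(#|S|, l) * f l.
Proof.
rewrite (partition_big (fun c : {set T} => inord #|c| : 'I_(#|S|.+1)) predT) //=.
apply: eq_bigr => l _; rewrite -(cards_draws S l) -sum_nat_const.
apply: eq_big => [c|c /andP[cS /eqP <-]]; last first.
  by rewrite inordK // ltnS subset_leq_card.
rewrite inE; case: (boolP (c \subset S)) => //= cS.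
by rewrite -val_eqE /= inordK // ltnS subset_leq_card.
Qed.

(** Write [n] for the size of [c].  Adding up the sizes of all cycles of all
    permutations of [c] gives [n * n!]; peeling off each cycle [d] in turn
    expresses the same total through the numbers of cyclic permutations of the
    subsets [d].  If the claim holds for all proper nonempty [d], each of the
    sizes [1], ..., [n-1] contributes [n!] to the total, which leaves [n!] for
    [d = c]. *)
Lemma card_cyclic_perms c : 0 < #|c| -> #|c| * #|cyclic_perms c| = #|c|`!.
Proof.
have [N] := ubnP #|c|; elim: N c => // N IH c /ltnSE-cN c_gt0.
have total : \sum_(d : {set T} | d \subset c)
    #|d| * (#|cyclic_perms d| * (#|c| - #|d|)`!) = #|c| * #|c|`!.
  rewrite -card_perm -[X in _ * X]sum1_card big_distrr /=.
  transitivity (\sum_(s | perm_on c s) \sum_(d in cycles c s) #|d|).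
    rewrite (exchange_big_dep (fun d => d \subset c)) /=; last first.
      by move=> s d cs; exact: cycles_sub.
    apply: eq_bigr => d dc; rewrite sum_nat_const mulnC; congr (_ * _).
    have := @sum_splice c d dc (fun=> 1).
    rewrite !sum1_card card_perm cardsD (setIidPr dc) => <-.
    by apply: eq_card => s.
  by apply: eq_bigr => s cs; rewrite sum_card_cycles // muln1.
have small d : d \subset c -> d != c -> 0 < #|d| ->
    #|d| * (#|cyclic_perms d| * (#|c| - #|d|)`!) = #|d|`! * (#|c| - #|d|)`!.
  move=> dc dNc d_gt0; rewrite mulnA IH //.
  by apply: leq_trans cN; rewrite proper_card // properEneq dNc.
have other : \sum_(d : {set T} | d \subset c)
    (0 < #|d|) * (#|d|`! * (#|c| - #|d|)`!) = #|c| * #|c|`!.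
  rewrite (sum_by_card c (fun l => (0 < l) * (l`! * (#|c| - l)`!))).
  rewrite big_ord_recl mul0n muln0 add0n.
  rewrite -[X in _ = X * _](card_ord #|c|) -sum_nat_const.
  by apply: eq_bigr => l _; rewrite mul1n bin_fact // -ltnS; exact: ltn_ord.
move: total; rewrite -other (bigD1 c) //= [RHS](bigD1 c) //=.
rewrite subnn c_gt0 mul1n !muln1 -[LHS]addnC -[RHS]addnC.
set R := (X in X + _ = _); set R' := (X in _ = X + _ -> _).
suff -> : R = R' by move/addnI.
apply: eq_bigr => d /andP[dc dNc].
have [-> //|d_gt0] := posnP #|d|.
by rewrite small // mul1n.
Qed.

End CyclesOn.

(** * Factorial moments of the cycle counts *)

Section FactorialMoments.

Variables (n : nat) (J : finType) (I : J -> {set 'I_n.+1}).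
Hypothesis I_disjoint : forall i j, i != j -> [disjoint I i & I j].

Definition has_length (T : finType) (j : J) (c : {set T}) : bool :=
  [exists i in I j, #|c| == i :> nat].

Lemma has_length_inj (T : finType) (c : {set T}) i j :
  has_length i c -> has_length j c -> i = j.
Proof.
case/existsP=> a /andP[Ia /eqP ca] /existsP[b /andP[Jb /eqP cb]].
apply/eqP/negPn/negP=> /I_disjoint /pred0P/(_ a) /=.
by rewrite Ia (_ : a = b) ?Jb //; apply/val_inj; rewrite /= -ca.
Qed.

Section OnType.

Variable T : finType.
Implicit Types (S c : {set T}) (P : {set {set T}}) (s : seq J).

Definition of_length j P : nat := #|[set c in P | has_length j c]|.

(** A product of falling factorials is indexed by a list [s] of classes, class
    [j] being repeated as often as its exponent says; adding a class to the list
    is then the choice of one more cycle. *)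
Definition falling_count P s : nat :=
  (\prod_j of_length j P ^_ count_mem j s)%N.

Lemma of_lengthD1 j P c : c \in P ->
  of_length j (P :\ c) = (of_length j P - has_length j c)%N.
Proof.
move=> Pc; rewrite /of_length.
have [jc|njc] := boolP (has_length j c).
  rewrite [in RHS](cardsD1 c) inE Pc jc add1n subSS subn0.
  by congr #|pred_of_set _|; apply/setP=> d; rewrite !inE andbA.
rewrite subn0; apply: eq_card => d; rewrite !inE.
by case: eqP => // ->; rewrite (negPf njc) !andbF.
Qed.

(** Choosing one cycle [c] of class [j] first lowers the count of class [j] by
    one and leaves those of the other classes unchanged, since they are disjoint
    from class [j]; this is the recursion [x ^_ m.+1 = x * x.-1 ^_ m]. *)
Lemma falling_count_cons P j s :
  falling_count P (j :: s) =
  (\sum_(c in P | has_length j c) falling_count (P :\ c) s)%N.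
Proof.
have step c : (c \in P) && has_length j c -> falling_count (P :\ c) s =
    ((of_length j P).-1 ^_ count_mem j s *
     \prod_(i | i != j) of_length i P ^_ count_mem i s)%N.
  case/andP=> Pc jc; rewrite /falling_count (bigD1 j) //=.
  rewrite of_lengthD1 // jc subn1; congr (_ * _)%N.
  apply: eq_bigr => i iNj; rewrite of_lengthD1 //.
  case: (boolP (has_length i c)) => [ic|]; last by rewrite subn0.
  by rewrite (has_length_inj ic jc) eqxx in iNj.
rewrite (eq_bigr _ step) sum_nat_cond_const /falling_count (bigD1 j) //=.
rewrite eqxx add1n ffactnS -mulnA; congr (_ * (_ * _))%N.
by apply: eq_bigr => i /negPf iNj; rewrite eq_sym iNj.
Qed.

Definition moment S s : nat :=
  (\sum_(p : {perm T} | perm_on S p) falling_count (cycles S p) s)%N.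

Lemma moment_cons S j s :
  moment S (j :: s) =
  (\sum_(c : {set T} | (c \subset S) && has_length j c)
     #|cyclic_perms c| * moment (S :\: c) s)%N.
Proof.
rewrite /moment; under eq_bigr do rewrite falling_count_cons.
rewrite (exchange_big_dep
  (fun c : {set T} => (c \subset S) && has_length j c)) /=; last first.
  by move=> p c Sp /andP[/(cycles_sub Sp) -> ->].
apply: eq_bigr => c /andP[cS jc].
rewrite -(sum_splice cS (falling_count^~ s)).
by apply: eq_bigl => p; rewrite jc andbT.
Qed.

(** For [s = [:: j_1; ...; j_M]], the sum of [1 / (l_1 * ... * l_M)] over all
    tuples with [l_t] in [I j_t] and [l_1 + ... + l_M <= N]. *)
Fixpoint truncated_product (N : nat) s : rat :=
  if s is j :: s' then
    \sum_(l in I j | (l <= N)%N) l%:R^-1 * truncated_product (N - l) s'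
  else 1.

(** For empty [c] both sides vanish: a cycle is nonempty and [1 / 0 = 0]. *)
Lemma cyclic_permsE c :
  #|cyclic_perms c|%:R = #|c|`!%:R / #|c|%:R :> rat.
Proof.
have [c0|c_gt0] := posnP #|c|.
  rewrite c0 invr0 mulr0 (_ : cyclic_perms c = set0) ?cards0 //.
  apply/setP=> p; rewrite !inE; apply/negP=> /andP[_ /cycles_nonempty].
  by rewrite c0.
by rewrite -card_cyclic_perms // natrM mulrC mulKf // pnatr_eq0 -lt0n.
Qed.

(** Grouping the peeled cycles by length, those of length [l <= N = #|S|]
    contribute ['C(N, l) * (l! / l) * (N - l)! = N! / l] times the truncated
    product for the [N - l] remaining points. *)
Lemma momentE S s :
  (moment S s)%:R = #|S|`!%:R * truncated_product #|S| s.
Proof.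
elim: s S => [|j s IH] S /=.
  rewrite mulr1 -card_perm -sum1_card; congr _%:R; apply: eq_bigr => p _.
  by rewrite /falling_count big1 // => j _; rewrite ffactn0.
rewrite moment_cons natr_sum.
pose g l := l`!%:R / l%:R * ((#|S| - l)`!%:R * truncated_product (#|S| - l) s).
transitivity (\sum_(c : {set T} | (c \subset S) && has_length j c) g #|c|).
  apply: eq_bigr => c /andP[cS _].
  by rewrite natrM IH cyclic_permsE cardsD (setIidPr cS).
rewrite (partition_big (fun c : {set T} => inord #|c| : 'I_n.+1)
  (fun l => (l \in I j) && (l <= #|S|)%N)) /=; last first.
  move=> c /andP[cS /existsP[l /andP[Il /eqP cl]]].
  by rewrite cl inord_val Il -cl subset_leq_card.
rewrite big_distrr /=; apply: eq_bigr => l /andP[Il lS].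
have in_class c : (c \subset S) && has_length j c && (inord #|c| == l) =
    (c \in [set A : {set T} | A \subset S & #|A| == l]).
  rewrite inE -andbA; case: (c \subset S) => //=.
  apply/andP/eqP => [[/existsP[i /andP[_ /eqP ci]] /eqP <-]|cl].
    by rewrite ci inord_val.
  by split; [apply/existsP; exists l; rewrite Il cl /= | rewrite cl inord_val].
rewrite (eq_bigl _ _ in_class).
rewrite (eq_bigr (fun=> g l)); last by move=> c; rewrite inE => /andP[_ /eqP->].
rewrite sumr_const cards_draws -[LHS]mulr_natr /g.
rewrite -(bin_fact lS) !natrM [LHS]mulrC -!mulrA.
by congr (_ * (_ * _)); rewrite mulrCA.
Qed.

End OnType.

(** * Comparison with the product of harmonic sums *)

Hypotheses (I_sub : forall j, I j \subset bracket n)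
  (I_nonempty : forall j, I j != set0).

Lemma length_gt0 j l : l \in I j -> (0 < l)%N.
Proof. by move/(subsetP (I_sub j)); rewrite inE. Qed.

Lemma harmonic_gt0 j : 0 < harmonic (I j).
Proof.
have [l Il] := set0Pn _ (I_nonempty j).
rewrite /harmonic (bigD1 l) //= ltr_wpDr //.
  by apply: sumr_ge0 => i _; rewrite invr_ge0 ler0n.
by rewrite invr_gt0 ltr0n (length_gt0 Il).
Qed.

(** The terms [l <= N] are compared by induction, and the terms [l > N], which
    the truncation omits, are a strict loss.  Equality thus needs
    [l + \sum_(j <- s) max_length (I j) <= N] for every [l] in the first class,
    and the largest [l] is decisive. *)
Lemma leif_truncated_product N (s : seq J) :
  truncated_product N s <= \prod_(j <- s) harmonic (I j)
    ?= iff (\sum_(j <- s) max_length (I j) <= N)%N.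
Proof.
elim: s N => [|j s IH] N /=; first by rewrite !big_nil; apply/leif_refl.
have prod_gt0 : 0 < \prod_(i <- s) harmonic (I i).
  by apply: prodr_gt0 => i _; exact: harmonic_gt0.
set M := \sum_(i <- s) max_length (I i) in IH *.
rewrite !big_cons [in X in _ <= X ?= iff _]/harmonic mulr_suml big_mkcondr /=.
have -> : (max_length (I j) + M <= N)%N =
    [forall (l | l \in I j), (l + M <= N)%N].
  apply/idP/forall_inP => [le_N l Il|le_N].
    by apply: leq_trans le_N; rewrite leq_add2r leq_bigmax_cond.
  have [|l Il maxE] := @eq_bigmax_cond _ (mem (I j)) (@nat_of_ord n.+1).
    by rewrite card_gt0.
  by rewrite /max_length maxE; exact: le_N.
apply: leif_sum => l Il; have l_gt0 := length_gt0 Il.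
have inv_gt0 : 0 < l%:R^-1 :> rat by rewrite invr_gt0 ltr0n.
case: (leqP l N) => [lN|Nl].
  have [le_IH eq_IH] := IH (N - l)%N; split; first by rewrite ler_pM2l.
  by rewrite (inj_eq (mulfI (lt0r_neq0 inv_gt0))) eq_IH leq_subRL.
have term_gt0 := mulr_gt0 inv_gt0 prod_gt0.
split; first exact: ltW.
rewrite lt_eqF //; apply/esym/negbTE; rewrite -ltnNge.
exact: leq_trans Nl (leq_addr _ _).
Qed.

End FactorialMoments.

Lemma cycles_setT (T : finType) (s : {perm T}) : cycles [set: T] s = porbits s.
Proof.
by apply/setP=> c; apply/imsetP/imsetP => -[x _ ->]; exists x.
Qed.

Theorem theorem1p3 (n k : nat) (I : 'I_k -> {set 'I_n.+1}) (m : 'I_k -> nat)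
    (n_ge1 : (1 <= n)%N)
    (I_sub : forall j, I j \subset bracket n)
    (I_nonempty : forall j, I j != set0)
    (I_disjoint : forall i j, i != j -> [disjoint I i & I j]) :
  let lhs := expectation
    (fun s : 'S_n => \prod_(j < k) ('C(cycle_count (I j) s, m j))%:R) in
  let rhs := \prod_(j < k) (harmonic (I j) ^+ m j / ((m j)`!)%:R) in
  lhs <= rhs /\
  (lhs = rhs <-> (\sum_(j < k) m j * max_length (I j) <= n)%N).
Proof.
move=> lhs rhs.
pose s := flatten [seq nseq (m j) j | j <- enum 'I_k].
pose D : rat := \prod_(j < k) (m j)`!%:R.
have D_gt0 : 0 < D by apply: prodr_gt0 => j _; rewrite ltr0n fact_gt0.
have D_neq0 := lt0r_neq0 D_gt0.
have count_s j : count_mem j s = m j.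
  rewrite count_flatten sumnE 2!big_map big_enum /= (bigD1 j) //=.
  rewrite count_nseq /= eqxx mul1n big1 ?addn0 // => i iNj.
  by rewrite count_nseq /= (negPf iNj).
(* [D] is the factor between binomial coefficients and falling factorials. *)
have lhsE : lhs = truncated_product I n s / D.
  rewrite /lhs /expectation card_Sn.
  have := momentE I_disjoint [set: 'I_n] s.
  rewrite cardsT card_ord => /(congr1 (fun x => x / n`!%:R)).
  rewrite mulrAC divff ?mul1r ?pnatr_eq0 -?lt0n ?fact_gt0 // => <-.
  rewrite mulrAC; congr (_ / _).
  apply: (mulIf D_neq0); rewrite divfK // mulr_suml natr_sum.
  apply: eq_big => [p|p _]; first by apply/esym/subsetP=> x; rewrite inE.
  rewrite /D -big_split /falling_count cycles_setT natr_prod /=.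
  by apply: eq_bigr => j _; rewrite -natrM bin_ffact count_s.
have rhsE : rhs = (\prod_(j <- s) harmonic (I j)) / D.
  rewrite /rhs big_split /= -prodfV; congr (_ * _).
  rewrite big_flatten big_map big_enum; apply: eq_bigr => j _.
  by rewrite big_nseq iter_mulr_1.
have sumE : (\sum_(j < k) m j * max_length (I j) =
    \sum_(j <- s) max_length (I j))%N.
  rewrite big_flatten big_map big_enum; apply: eq_bigr => j _.
  by rewrite big_nseq iter_addn_0 mulnC.
have [le_tr eq_tr] := leif_truncated_product I_sub I_nonempty n s.
rewrite lhsE rhsE sumE -eq_tr ler_pM2r ?invr_gt0 //; split=> //.
by split=> [/(mulIf (invr_neq0 D_neq0)) -> // | /eqP ->].
Qed.
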